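(* Let $\mathcal{H}=(V,E)$ be a connected hypergraph and let $F=\{e_1,\dots,e_t\}\subseteq E$ with divisions $e_i=e_i'\cup e_i''$ such that $(F,F',F'')$ is a weak cut, where $F'=\{e_1',\dots,e_t'\}$, $F''=\{e_1'',\dots,e_t''\}$. Then $\mathcal{E}(\mathcal{H}\triangleleft(F,F',F''))\le\mathcal{E}(\mathcal{H})$.
   Context: A hypergraph $\mathcal{H}=(V,E)$ consists of a finite vertex set $V$ and a set $E$ of edges, each a subset of $V$ of cardinality at least $2$ (distinct edges distinct). A multi-hypergraph is a pair $(V,E)$ with $E$ a multiset of subsets of $V$ (of any cardinality). For a (multi-)hypergraph and $i\neq j$, $d(\{i,j\})$ is the number of edges (with multiplicity) containing both $i$ and $j$; the adjacency matrix has zero diagonal and $(i,j)$ entry $d(\{i,j\})$, and the energy $\mathcal{E}$ is the sum of absolute values of its eigenvalues. A walk is a sequence $v_0e_1v_1\dots e_lv_l$ with $v_{i-1},v_i$ distinct vertices of the edge $e_i$; a (multi-)hypergraph is connected if every two vertices are joined by a walk, and disconnected otherwise. Given $F=\{e_1,\dots,e_t\}\subseteq E$ and divisions $e_i=e_i'\cup e_i''$ with $e_i',e_i''$ nonempty and disjoint, $\mathcal{H}\triangleleft(F,F',F'')$ is the multi-hypergraph $(V,(E\cup F'\cup F'')\setminus F)$ (edges of $F$ replaced by their two parts). For a connected hypergraph, $(F,F',F'')$ is a weak cut if $\mathcal{H}\triangleleft(F,F',F'')$ is disconnected and, for no proper subset $P\subsetneq F$ and no choice of divisions of the edges of $P$,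 is the multi-hypergraph obtained by dividing the edges of $P$ disconnected. *)

(* Defs.v *)
From mathcomp Require Import all_boot all_order all_algebra.
From mathcomp Require Import finmap multiset.

Set Implicit Arguments.
Unset Strict Implicit.
Unset Printing Implicit Defensive.

Import Order.TTheory GRing.Theory Num.Theory.

Local Open Scope ring_scope.

(* The vertex set is the whole finite type V. *)
Record hypergraph (V : finType) := Hypergraph {
  hedges :> {set {set V}};
  hedges_card : [forall e in hedges, (1 < #|e|)%N]
}.

Definition multihypergraph (V : finType) := {mset {set V}}%mset.

Definition multi_of (V : finType) (E : {set {set V}}) : multihypergraph V :=
  seq_mset (enum E).

Definition codegree (V : finType) (M : multihypergraph V) (x y : V) : nat :=
  (\sum_(e : {set V} | (x \in e) && (y \in e)) M e)%N.

Definition adjacency (C : numClosedFieldType) (V : finType)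
    (M : multihypergraph V) : 'M[C]_#|V| :=
  \matrix_(i, j) if i == j then 0
                 else (codegree M (enum_val i) (enum_val j))%:R.

(* The eigenvalues, with algebraic multiplicity: the roots of the
   characteristic polynomial over the algebraically closed field C. *)
Definition eigenvalues (C : numClosedFieldType) (n : nat) (A : 'M[C]_n) :
    seq C :=
  sval (closed_field_poly_normal (char_poly A)).

Definition energy (C : numClosedFieldType) (V : finType)
    (M : multihypergraph V) : C :=
  \sum_(z <- eigenvalues (adjacency C M)) `|z|.

(* [walk M v0 [:: (e1, v1); ...; (el, vl)]] says that v0 e1 v1 ... el vl is a
   walk. *)
Fixpoint walk (V : finType) (M : multihypergraph V) (x : V)
    (w : seq ({set V} * V)) : bool :=
  if w is (e, y) :: w' then
    [&& e \in M, x \in e, y \in e, x != y & walk M y w']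
  else true.

Definition connected (V : finType) (M : multihypergraph V) : Prop :=
  forall x y : V,
    exists2 w : seq ({set V} * V), walk M x w & last x (unzip2 w) = y.

Definition disconnected (V : finType) (M : multihypergraph V) : Prop :=
  ~ connected M.

(* A choice of divisions of the edges of F is a pair of functions, sending e to
   e' and to e''; only their values on F matter. *)
Definition divides_edges (V : finType) (F : {set {set V}})
    (d1 d2 : {set V} -> {set V}) : Prop :=
  forall e, e \in F ->
    [/\ e = d1 e :|: d2 e, [disjoint d1 e & d2 e], d1 e != set0
      & d2 e != set0].

(* The union is the sum of multisets: equal parts of different edges, or parts
   that are already edges of H, are counted with multiplicity. *)
Definition divide_edges (V : finType) (H : hypergraph V) (F : {set {set V}})
    (d1 d2 : {set V} -> {set V}) : multihypergraph V :=
  ((multi_of H `+` seq_mset [seq d1 e | e <- enum F]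
               `+` seq_mset [seq d2 e | e <- enum F]) `\` multi_of F)%mset.

Definition weak_cut (V : finType) (H : hypergraph V) (F : {set {set V}})
    (d1 d2 : {set V} -> {set V}) : Prop :=
  [/\ F \subset hedges H,
      divides_edges F d1 d2,
      disconnected (divide_edges H F d1 d2)
    & forall (P : {set {set V}}) (c1 c2 : {set V} -> {set V}),
        P \proper F -> divides_edges P c1 c2 ->
        ~ disconnected (divide_edges H P c1 c2)].

(* Main.v *)
(* Let [S] be a union of components of the divided hypergraph. Minimality forces
   every divided edge to have one part inside [S] and the other outside: if both
   parts were on the same side, that edge could be left undivided. Hence the
   new adjacency matrix [B] is the block-diagonal part of the old one [A] for the
   partition [S], [~: S], that is, [2 B = A + D A D] with [D] the diagonal matrix
   of signs of [S]. For a normal matrix the energy is the maximum of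
   [|tr (U A)|] over unitary [U], so the energy of [B] is at most that of [A]. *)

Require Import Defs.
From mathcomp Require Import all_boot all_order all_algebra.
From mathcomp Require Import finmap multiset.

Set Implicit Arguments.
Unset Strict Implicit.
Unset Printing Implicit Defensive.

Import Order.TTheory GRing.Theory Num.Theory.

Local Open Scope ring_scope.
Local Open Scope sesquilinear_scope.

(** * Eigenvalue sums of normal matrices and unitary traces *)

Lemma char_poly_conj (R : comUnitRingType) (n : nat) (P A : 'M[R]_n) :
  P \in unitmx -> char_poly (invmx P *m A *m P) = char_poly A.
Proof.
move=> Pu; rewrite /char_poly.
have -> : char_poly_mx (invmx P *m A *m P) =
    map_mx polyC (invmx P) *m char_poly_mx A *m map_mx polyC P.
  rewrite /char_poly_mx mulmxBr mulmxBl -!map_mxM; congr (_ - _).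
  by rewrite scalar_mxC -mulmxA -map_mxM mulVmx // map_mx1 mulmx1.
by rewrite !det_mulmx mulrC mulrA -det_mulmx -map_mxM mulmxV // map_mx1 det1
           mul1r.
Qed.

Section TraceNorm.
Variable C : numClosedFieldType.
Implicit Types z : C.

(** For normal [A] this is the trace norm, the sum of the singular values. *)
Definition eig_abs_sum n (A : 'M[C]_n) : C := \sum_(z <- eigenvalues A) `|z|.

(** Unitary diagonalization factors the characteristic polynomial over [spectral_diag A], and the
    linear factors determine the roots up to order. *)
Lemma eig_abs_sumE n (A : 'M[C]_n) : A \is normalmx ->
  eig_abs_sum A = \sum_i `|spectral_diag A 0 i|.
Proof.
move=> /orthomx_spectralP eA; set d := spectral_diag A.
rewrite /eig_abs_sum (perm_big [seq d 0 i | i : 'I_n]) /=.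
  by rewrite big_map big_enum.
apply: prod_XsubC_eq; rewrite big_map big_enum /=.
rewrite /eigenvalues; case: closed_field_poly_normal => r /=.
rewrite (monicP (char_poly_monic A)) scale1r => <-.
rewrite eA char_poly_conj ?spectral_unit // char_poly_trig ?diag_mx_is_trig //.
by apply: eq_bigr => i _; rewrite mxE eqxx.
Qed.

(** Each row has unit length, and the squared modulus of an entry is one term of that sum. *)
Lemma unitarymx_norm_le1 n (U : 'M[C]_n) i j : U \is unitarymx -> `|U i j| <= 1.
Proof.
move=> /unitarymxP/matrixP/(_ i i); rewrite !mxE eqxx => sumU.
have: `|U i j| ^+ 2 <= 1 ^+ 2.
  rewrite expr1n -[leRHS]sumU (bigD1 j) //= !mxE -normCK lerDl sumr_ge0 // => k _.
  by rewrite !mxE -normCK exprn_ge0.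
by rewrite ler_pXn2r ?nnegrE.
Qed.

Lemma mxtrace_diag_mul n (W : 'M[C]_n) (d : 'rV[C]_n) :
  \tr (W *m diag_mx d) = \sum_i W i i * d 0 i.
Proof. by apply: eq_bigr => i _; rewrite mul_mx_diag mxE. Qed.

(** In an eigenbasis of [A] the trace is the sum of the eigenvalues weighted by the diagonal entries
    of a unitary conjugate of [U], each of modulus at most 1. *)
Lemma mxtrace_unitary_le n (U A : 'M[C]_n) :
  U \is unitarymx -> A \is normalmx -> `|\tr (U *m A)| <= eig_abs_sum A.
Proof.
move=> uU nA; rewrite eig_abs_sumE //; set d := spectral_diag A.
have /orthomx_spectralP := nA; rewrite -/d; set P := spectralmx A => ->.
have uP : P \is unitarymx by apply: spectral_unitarymx.
rewrite invmx_unitary // mulmxA mxtrace_mulC !mulmxA mxtrace_diag_mul.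
apply: le_trans (ler_norm_sum _ _ _) _; apply: ler_sum => i _.
rewrite normrM ler_piMl // unitarymx_norm_le1 // !mul_unitarymx //.
by rewrite trmxC_unitary.
Qed.

Lemma exists_phase z : exists2 w : C, w * w^* = 1 & w * z = `|z|.
Proof.
have [-> | z0] := eqVneq z 0.
  by exists 1; rewrite ?conjC1 ?mulr0 ?normr0 ?mul1r.
exists (`|z| / z); last by rewrite divfK.
by rewrite -normCK normrM normfV normr_id divff ?normr_eq0 ?expr1n.
Qed.

(** The witness is diagonal in the eigenbasis of [A], with phases that rotate every eigenvalue onto
    its modulus. *)
Lemma mxtrace_unitary_attained n (A : 'M[C]_n) : A \is normalmx ->
  exists2 U, U \is unitarymx & \tr (U *m A) = eig_abs_sum A.
Proof.
move=> nA; rewrite eig_abs_sumE //; set d := spectral_diag A.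
have /orthomx_spectralP := nA; rewrite -/d; set P := spectralmx A => ->.
have uP : P \is unitarymx by apply: spectral_unitarymx.
have /fin_all_exists2[w w1 wd] : forall i,
    exists2 w : C, w * w^* = 1 & w * d 0 i = `|d 0 i|.
  by move=> i; apply: exists_phase.
pose W : 'M[C]_n := diag_mx (\row_i w i).
exists (P ^t* *m W *m P).
  rewrite !mul_unitarymx ?trmxC_unitary //; apply/unitarymxP.
  rewrite tr_diag_mx map_diag_mx mulmx_diag -diag_const_mx; congr diag_mx.
  by apply/rowP => i; rewrite !mxE w1.
rewrite invmx_unitary // mulmxA mxtrace_mulC !mulmxA (unitarymxP uP) mul1mx.
rewrite -(mulmxA W) (unitarymxP uP) mulmx1.
by rewrite mxtrace_diag_mul; apply: eq_bigr => i _; rewrite !mxE eqxx wd.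
Qed.

Lemma pinching_eig_abs_sum n (S : {set 'I_n}) (A B : 'M[C]_n) :
    A \is normalmx -> B \is normalmx ->
    (forall i j, B i j = if (i \in S) == (j \in S) then A i j else 0) ->
  eig_abs_sum B <= eig_abs_sum A.
Proof.
move=> nA nB BA; have [U uU trU] := mxtrace_unitary_attained nB.
pose D : 'M[C]_n := diag_mx (\row_i (-1) ^+ (i \in S)).
have uD : D \is unitarymx.
  apply/unitarymxP; rewrite tr_diag_mx map_diag_mx mulmx_diag -diag_const_mx.
  congr diag_mx; apply/rowP => i.
  by rewrite !mxE rmorphXn rmorphN1 -signr_addb addbb.
have B2 : B *+ 2 = A + D *m A *m D.
  apply/matrixP => i j; rewrite mul_diag_mx mul_mx_diag !mxE.
  rewrite mulrAC -signr_addb BA.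
  by do 2 case: (_ \in _); rewrite /= ?mul1r ?mulN1r ?subrr ?addr0.
(* Cyclicity of the trace moves both factors [D] from [A] to [U]; since [D *m U *m D] is again
   unitary, each trace is bounded by [eig_abs_sum A]. *)
have trB : eig_abs_sum B *+ 2 = \tr (U *m A) + \tr (D *m U *m D *m A).
  have -> : \tr (D *m U *m D *m A) = \tr (U *m (D *m A *m D)).
    by rewrite !mulmxA [RHS]mxtrace_mulC !mulmxA.
  have := congr1 (fun X => \tr (U *m X)) B2.
  by rewrite mulr2n !mulmxDr !mxtraceD trU -mulr2n.
have eB : 0 <= eig_abs_sum B by apply: sumr_ge0.
have: eig_abs_sum B *+ 2 <= eig_abs_sum A *+ 2; last by rewrite lerMn2r.
rewrite -[leLHS]ger0_norm ?mulrn_wge0 // trB mulr2n.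
apply: le_trans (ler_normD _ _) (lerD _ _); apply: mxtrace_unitary_le => //.
by rewrite !mul_unitarymx.
Qed.
End TraceNorm.

(** * Separating sets and codegrees of divided hypergraphs *)

Section Multi.
Variable V : finType.
Implicit Types (M N : multihypergraph V) (E F : {set {set V}}) (S : {set V}).

Lemma multi_of_split E F :
  F \subset E -> multi_of E = (multi_of (E :\: F) `+` multi_of F)%mset.
Proof.
move=> sFE; apply/msetP => e; rewrite msetE2 !mset_seqE.
rewrite !count_uniq_mem ?enum_uniq // !mem_enum inE.
by case: (boolP (e \in F)) => [/(subsetP sFE) -> | _]; rewrite ?addn0.
Qed.

(** Eliminates the truncated multiset difference: the copies of [F] removed are exactly those split
    off from [H], whatever the parts coincide with. *)
Lemma divide_edgesE (H : hypergraph V) F d1 d2 : F \subset hedges H ->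
  divide_edges H F d1 d2 =
  (multi_of (hedges H :\: F) `+` seq_mset [seq d1 e | e <- enum F]
     `+` seq_mset [seq d2 e | e <- enum F])%mset.
Proof.
move=> sFH; rewrite /divide_edges (multi_of_split sFH).
by apply/msetP => e; rewrite !msetE2; rewrite -!addnA addnCA addKn.
Qed.

Lemma codegreeD M N x y :
  codegree (M `+` N)%mset x y = (codegree M x y + codegree N x y)%N.
Proof. by rewrite -big_split; apply: eq_bigr => e _; rewrite msetE2. Qed.

Lemma codegree_seq_mset (s : seq {set V}) x y :
  codegree (seq_mset s) x y = count (fun e : {set V} => (x \in e) && (y \in e)) s.
Proof.
rewrite /codegree; under eq_bigr do rewrite mset_seqE.
elim: s => [|e s IHs] /=; first by rewrite big1.
rewrite big_split IHs /=; congr addn; rewrite big_mkcond (bigD1 e) //= eqxx.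
rewrite big1 ?addn0 => [|f /negPf fe]; first by case: ifP.
by rewrite eq_sym fe if_same.
Qed.

(** An edgewise way to say that [S] is a union of components, usable without walks. *)
Definition separates S M :=
  forall e, e \in M -> (e \subset S) || (e \subset ~: S).

Lemma separated_walk S M x w :
  separates S M -> walk M x w -> (last x (unzip2 w) \in S) = (x \in S).
Proof.
move=> sep; elim: w x => [|[e y] w IHw] x //= /and5P[eM xe ye _ /IHw ->].
case/orP: (sep e eM) => /subsetP eS; first by rewrite !eS.
by have:= eS x xe; have:= eS y ye; rewrite !inE => /negPf -> /negPf ->.
Qed.

Lemma separated_disconnected S M x y :
  separates S M -> x \in S -> y \notin S -> disconnected M.
Proof.
move=> sep xS /negP yS /(_ x y)[w Mw wy]; apply: yS.
by rewrite -wy (separated_walk sep Mw).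
Qed.

Lemma disconnected_separated M : disconnected M ->
  exists S x y, [/\ separates S M, x \in S & y \notin S].
Proof.
(* Unlike a step of a walk, [r] allows equal endpoints; such steps are dropped when a path is turned
   into a walk. *)
pose r x y := [exists e : {set V}, [&& e \in M, x \in e & y \in e]].
have path_walk x p : path r x p ->
    exists2 w, walk M x w & last x (unzip2 w) = last x p.
  elim: p x => [|y p IHp] x /=; first by exists [::].
  case/andP=> /existsP[e /and3P[eM xe ye]] /IHp[w Mw wp].
  have [xy | xy] := eqVneq x y; first by exists w; rewrite ?xy.
  by exists ((e, y) :: w); rewrite //= eM xe ye xy.
move=> dM; have [/forallP conn | ] := boolP [forall x, forall y, connect r x y].
  case: dM => x y; have /forallP/(_ y)/connectP[p rp ->] := conn x.
  exact: path_walk.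
case/forallPn=> x /forallPn[y nxy]; exists [set z | connect r x z], x, y.
split; rewrite ?inE ?connect0 // => e eM.
(* An edge that meets the component of [x] lies inside it, and any other edge lies in the
   complement. *)
have [/existsP[z /andP[ze xz]] | ] := boolP [exists z in e, connect r x z].
  apply/orP; left; apply/subsetP => u ue; rewrite inE.
  apply: connect_trans xz (connect1 _).
  by apply/existsP; exists e; rewrite eM ze.
move/exists_inPn=> nxe; apply/orP; right; apply/subsetP => u ue.
by rewrite !inE nxe.
Qed.

Lemma separated_codegree S M x y :
  separates S M -> (x \in S) != (y \in S) -> codegree M x y = 0%N.
Proof.
move=> sep xyS; apply: big1 => e /andP[xe ye]; apply/eqP.
rewrite -leqn0 leqNgt -in_mset; apply: contra xyS => /sep.
case/orP=> /subsetP eS; first by rewrite !eS.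
by have:= eS x xe; have:= eS y ye; rewrite !inE => /negPf -> /negPf ->.
Qed.

Lemma mem_divide_edges (H : hypergraph V) F d1 d2 e : F \subset hedges H ->
  (e \in divide_edges H F d1 d2) =
  [|| e \in hedges H :\: F, e \in d1 @: F | e \in d2 @: F].
Proof.
move=> sFH; rewrite divide_edgesE // !in_msetD -orbA.
have mem_image (d : {set V} -> {set V}) :
    (e \in seq_mset [seq d f | f <- enum F]) = (e \in d @: F).
  rewrite (perm_mem (perm_eq_seq_mset _)); apply/mapP/imsetP => -[f fF ->].
    by exists f; rewrite // mem_enum in fF *.
  by exists f; rewrite ?mem_enum.
by rewrite !mem_image /multi_of (perm_mem (perm_eq_seq_mset _)) mem_enum.
Qed.

Lemma weak_cut_straddle (H : hypergraph V) F d1 d2 S x y :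
    weak_cut H F d1 d2 -> separates S (divide_edges H F d1 d2) ->
    x \in S -> y \notin S ->
  forall f, f \in F ->
    (d1 f \subset S) && (d2 f \subset ~: S)
    || (d1 f \subset ~: S) && (d2 f \subset S).
Proof.
case=> sFH divF _ minF sep xS yS f fF.
have sPF : F :\ f \subset F by rewrite subsetDl.
have sPH := subset_trans sPF sFH.
have [fE _ _ _] := divF f fF.
(* Were [f] on one side, dividing only [F :\ f] would still leave [S] separating [x] from [y],
   against minimality. *)
have fnsep : ~~ ((f \subset S) || (f \subset ~: S)).
  apply/negP=> fsep; apply: (minF (F :\ f) d1 d2).
  - by rewrite properD1.
  - by move=> e /(subsetP sPF)/divF.
  apply: separated_disconnected xS yS => e; rewrite mem_divide_edges //.
  have [-> // | ef] := eqVneq e f.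
  move=> eP; apply: sep; rewrite mem_divide_edges //.
  case/or3P: eP => [|/(subsetP (imsetS d1 sPF)) ->|/(subsetP (imsetS d2 sPF)) ->];
    rewrite ?orbT // => eP.
  by rewrite !inE ef in eP; rewrite inE eP.
have d1M : d1 f \in divide_edges H F d1 d2.
  by rewrite mem_divide_edges // imset_f ?orbT.
have d2M : d2 f \in divide_edges H F d1 d2.
  by rewrite mem_divide_edges // (imset_f d2 fF) !orbT.
have fT (T : {set V}) : (f \subset T) = (d1 f \subset T) && (d2 f \subset T).
  by rewrite -subUset -fE.
(* Each part lies on one side but their union does not, so the sides are opposite. *)
move: (sep _ d1M) (sep _ d2M) fnsep; rewrite !fT.
by do 4 case: (_ \subset _).
Qed.

(** Two vertices on the same side lie together in an edge of [F] exactly when they lie together in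
    its part on that side, so division preserves the count. *)
Lemma weak_cut_codegree (H : hypergraph V) F d1 d2 S x y :
    F \subset hedges H -> divides_edges F d1 d2 ->
    (forall f, f \in F ->
      (d1 f \subset S) && (d2 f \subset ~: S)
      || (d1 f \subset ~: S) && (d2 f \subset S)) ->
    (x \in S) = (y \in S) ->
  codegree (divide_edges H F d1 d2) x y = codegree (multi_of H) x y.
Proof.
move=> sFH divF cutF xyS; rewrite divide_edgesE // (multi_of_split sFH).
rewrite !codegreeD !codegree_seq_mset !count_map -addnA -count_predUI.
(* The intersection term of inclusion-exclusion vanishes because the two parts of an edge are
   disjoint. *)
rewrite [X in (_ + (_ + X))%N](eq_in_count (a2 := pred0)) => [|f]; last first.
  rewrite mem_enum => /divF[_ dis _ _] /=.
  by case: (boolP (x \in d1 f)) => // xf; rewrite (disjointFr dis xf) andbF.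
rewrite count_pred0 addn0; congr addn; apply: eq_in_count => f.
rewrite mem_enum => fF /=; have [fE _ _ _] := divF f fF.
rewrite [in RHS]fE !inE.
case/orP: (cutF f fF) => /andP[/subsetP s1 /subsetP s2];
  move: (s1 x) (s1 y) (s2 x) (s2 y); rewrite !inE -xyS;
  case: (x \in d1 f); case: (y \in d1 f); case: (x \in d2 f);
  case: (y \in d2 f); case: (x \in S) => //= a b c d;
  by [move: (a isT) | move: (b isT) | move: (c isT) | move: (d isT)].
Qed.
End Multi.

Lemma adjacency_normal (C : numClosedFieldType) (V : finType)
    (M : multihypergraph V) : adjacency C M \is normalmx.
Proof.
apply: symmetric_normalmx.
  apply/is_hermitianmxP; rewrite expr0 scale1r; apply/matrixP => i j.
  rewrite !mxE eq_sym; congr (if _ then _ else _%:R).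
  by apply: eq_bigl => e; rewrite andbC.
by apply/mxOverP => i j; rewrite mxE; case: ifP.
Qed.

Theorem theorem16 (C : numClosedFieldType) (V : finType) (H : hypergraph V)
    (F : {set {set V}}) (d1 d2 : {set V} -> {set V}) :
  connected (multi_of H) ->
  weak_cut H F d1 d2 ->
  energy C (divide_edges H F d1 d2) <= energy C (multi_of H).
Proof.
move=> _ wcut; have [sFH divF dis _] := wcut.
have [S [x [y [sep xS yS]]]] := disconnected_separated dis.
have cutF := weak_cut_straddle wcut sep xS yS.
(* Matrix indices enumerate the vertices, so [S] is transported along [enum_val]. Diagonal entries
   vanish on both sides; the others are compared by codegree, within a side and across. *)
apply: (@pinching_eig_abs_sum C _ [set i | enum_val i \in S]);
  rewrite ?adjacency_normal // => i j; rewrite !mxE !inE.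
case: (eqVneq i j) => [|_]; first by rewrite if_same.
case: eqP => [ijS | /eqP ijS]; first by rewrite (weak_cut_codegree sFH divF cutF).
by rewrite (separated_codegree sep).
Qed.
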